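(* If $1/n<\lambda\to0$, then with probability at least $1-4e^{-s_\lambda}$, $$\sum_{i=\widehat s_\lambda+1}^n\widehat\mu_i\le Cs_\lambda\mu_{s_\lambda},$$ where $C>0$ is an absolute constant.
   Context: $x_1,\dots,x_n$ are i.i.d. from a distribution $P_X$ on $\mathcal{X}\subseteq\mathbb{R}^d$. $\mathcal{H}\subset L^2(P_X)$ is an RKHS with inner product $\langle\cdot,\cdot\rangle_{\mathcal{H}}$ and reproducing kernel $K(x,x')=\sum_{i=1}^\infty\mu_i\phi_i(x)\phi_i(x')$, with ordered eigenvalues $\mu_1\ge\mu_2\ge\cdots\ge0$, where $\{\phi_i\}$ is a basis of $L^2(P_X)$ with $\langle\phi_i,\phi_j\rangle_{L^2(P_X)}=\delta_{ij}$ and $\langle\phi_i,\phi_j\rangle_{\mathcal{H}}=\delta_{ij}/\mu_i$. Assumption A1 (standing): $\sup_{i\ge1}\|\phi_i\|_{\sup}<\infty$ and $\sup_{k\ge1}\frac{\sum_{i=k+1}^\infty\mu_i}{k\mu_k}<\infty$. $\widehat\mu_1\ge\cdots\ge\widehat\mu_n\ge0$ are the eigenvalues of the empirical kernel matrix $\boldsymbol{K}=[n^{-1}K(x_i,x_j)]_{1\le i,j\le n}$. For $\lambda>0$, $\widehat s_\lambda=\min\{i:\widehat\mu_i\le\lambda\}-1$ and $s_\lambda=\min\{i:\mu_i\le\lambda\}-1$ are the numbers of $\widehat\mu_i$'s, respectively $\mu_i$'s, greater than $\lambda$. ''Absolute constant'' means a constant not depending on $n$, $\lambda$ or the sample; it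 may depend on the fixed kernel. *)

(* Defs.v *)
From HB Require Import structures.
From mathcomp Require Import all_boot all_order all_algebra.
From mathcomp Require Import all_classical all_reals all_analysis.

Set Implicit Arguments.
Unset Strict Implicit.
Unset Printing Implicit Defensive.

Import Order.TTheory GRing.Theory Num.Theory.
Import numFieldNormedType.Exports.

Local Open Scope classical_set_scope.
Local Open Scope ring_scope.

(* All families numbered from 1 in the mathematics (mu_i, phi_i and the       *)
(* eigenvalues of the empirical kernel matrix) are numbered from 0 here: the  *)
(* k-th term, k >= 1, is the term of index k.-1.                              *)

(* A subset A of a measurable space, with the trace sigma-algebra.  A itself  *)
(* need not be measurable; the point a : A only serves the requirement that   *)
(* measurable types be pointed.                                               *)
Definition points (T : choiceType) (A : set T) (a : A) : Type := A.

HB.instance Definition _ (T : choiceType) (A : set T) (a : A) :=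
  Choice.copy (points a) (set_type A).
HB.instance Definition _ (T : choiceType) (A : set T) (a : A) :=
  isPointed.Build (points a) a.

Definition trace_space (d : measure_display) (T : measurableType d)
    (A : set T) (a : A) : measurableType _ :=
  g_sigma_algebra_preimageType (fun x : points a => (\val x : T)).

Section rkhs.
Context {R : realType} {T : Type}.
Implicit Types (H : set (T -> R)) (ip : (T -> R) -> (T -> R) -> R).

(* ip is only meaningful on H *)
Definition is_hilbert_space H ip : Prop :=
  [/\ H (fun=> 0) /\
      (forall (a : R) f g, H f -> H g -> H (fun x => a * f x + g x)),
      forall f g, H f -> H g -> ip f g = ip g f,
      forall (a : R) f g h, H f -> H g -> H h ->
        ip (fun x => a * f x + g x) h = a * ip f h + ip g h,
      forall f, H f -> 0 <= ip f f /\ (ip f f = 0 -> f = (fun=> 0)) &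
      forall u : nat -> T -> R, (forall n, H (u n)) ->
        (forall e : R, 0 < e -> exists N, forall m n, (N <= m)%N -> (N <= n)%N ->
           ip (u m \- u n) (u m \- u n) < e) ->
        exists2 f, H f &
          (fun n => ip (u n \- f) (u n \- f)) @ \oo --> 0].

Definition is_rkhs H ip (K : T -> T -> R) : Prop :=
  [/\ is_hilbert_space H ip,
      forall x, H (K x) &
      forall x f, H f -> ip f (K x) = f x].

Definition sup_norm (f : T -> R) : \bar R :=
  ereal_sup (range (fun x => `|f x|%:E)).

End rkhs.

Definition is_L2_orthonormal_basis (R : realType) (d : measure_display)
    (T : measurableType d) (P : probability T R) (phi : nat -> T -> R) : Prop :=
  [/\ forall i, phi i \in Lfun P 2%:E,
      forall i j, Rintegral P setT (fun x => phi i x * phi j x) = (i == j)%:R &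
      forall f, f \in Lfun P 2%:E -> exists c : nat -> R,
        (fun n => 'N[P]_2%:E[EFin \o (fun x =>
            f x - \sum_(0 <= i < n) c i * phi i x)%R]%E) @ \oo --> 0%E].

(* If mu vanishes from some index on, the ratio reads 0 / 0, which is         *)
(* 0 * +oo = 0 in \bar R and hence imposes nothing.                           *)
Definition assumption_A1 (R : realType) (T : Type)
    (mu : nat -> R) (phi : nat -> T -> R) : Prop :=
  (ereal_sup (range (fun i => sup_norm (phi i))) < +oo)%E /\
  (ereal_sup [set ((\sum_(k <= i <oo) (mu i)%:E) / (k%:R * mu k.-1)%:E)%E
             | k in [set k | (1 <= k)%N]] < +oo)%E.

Definition iid (R : realType) (dO d : measure_display)
    (Omega : measurableType dO) (T : measurableType d)
    (P : probability Omega R) (PX : probability T R)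
    (n : nat) (x : 'I_n -> {RV P >-> T}) : Prop :=
  (forall i B, measurable B -> distribution P (x i) B = PX B) /\
  (forall (J : {set 'I_n}) (B : 'I_n -> set T),
     (forall i, measurable (B i)) ->
     P [set w | forall i, i \in J -> B i (x i w)] =
     (\prod_(i in J) P (x i @^-1` B i))%E).

(* min {i >= 1 : mu_i <= lam} - 1, with mu_i stored at index i.-1 *)
Definition s_rank (R : realType) (mu : nat -> R) (lam : R) : nat :=
  xget 0%N [set i | mu i <= lam /\ forall j, mu j <= lam -> (i <= j)%N].

Definition empirical_kernel (R : realType) (T : Type) (K : T -> T -> R)
    (n : nat) (x : 'I_n -> T) : 'M[R]_n :=
  \matrix_(i < n, j < n) (n%:R^-1 * K (x i) (x j)).

(* Nonincreasing list of the eigenvalues, with algebraic multiplicity; it     *)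
(* exists, and is unique, as soon as char_poly A splits over R, in particular *)
(* for symmetric A.                                                           *)
Definition ordered_eigenvalues (R : realType) (n : nat) (A : 'M[R]_n) : seq R :=
  xget [::] [set s | sorted >=%R s /\ char_poly A = \prod_(a <- s) ('X - a%:P)].

(* min {i : s_i <= lam} - 1, and the length of s if there is no such i *)
Definition shat_rank (R : realType) (s : seq R) (lam : R) : nat :=
  find (fun a => a <= lam) s.

(* Main.v *)
Require Import Defs.
From HB Require Import structures.
From mathcomp Require Import all_boot all_order all_algebra.
From mathcomp Require Import perm spectral sesquilinear complex.
From mathcomp Require Import all_classical all_reals all_analysis.

Set Implicit Arguments.
Unset Strict Implicit.
Unset Printing Implicit Defensive.

Import Order.TTheory GRing.Theory Num.Theory.
Import numFieldNormedType.Exports.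

Local Open Scope classical_set_scope.
Local Open Scope ring_scope.

(** Write s for the number of mu_i above lambda.  If s = 0 the lower bound on
    the probability is negative.  If s >= 1 the inequality holds for every
    sample x_1, ..., x_n, so that the event is the whole space:

    - split K = K' + K'' where K' keeps the first s terms of the Mercer
      expansion; accordingly the empirical kernel matrix is A + B, where A has
      rank at most s and B is positive semidefinite;
    - the eigenvalues of A + B beyond the s-th add up to at most the trace of
      B (sum_tail_eigenvalues_le_mxtrace), a form of Ky Fan's inequality.
      Indeed let Q be the orthogonal projection onto the kernel of A.  In an
      orthonormal eigenbasis of A + B the diagonal entries p_i of Q lie in
      [0, 1] and add up to at least n - s, so tr (Q (A + B)) = sum_i p_i l_i is
      at least the sum of the smallest n - s eigenvalues l_i
      (sorted_sum_tail_le), while Q A = 0 gives tr (Q (A + B)) = tr (Q B)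
      <= tr B;
    - tr B is a mean over the sample of sum_(i > s) mu_i phi_i(x_j)^2, which is
      at most b^2 sum_(i > s) mu_i <= b^2 c s mu_s, where b bounds every
      |phi_i| and c bounds the tail ratios of the mu_i
      (tail_kernel_diag_le, assumption_A1_tail_bounded);
    - those of the s largest empirical eigenvalues that are at most lambda
      contribute at most s lambda <= s mu_s.

    Hence C = 1 + b^2 c works.  The spectral theorem is used over R[i], to
    which real symmetric matrices are transported. *)

(** * Eigenvalues of Hermitian matrices *)

Section hermitian.
Local Open Scope sesquilinear_scope.

Lemma char_poly_conj (F : fieldType) n (P D : 'M[F]_n) : P \in unitmx ->
  char_poly (invmx P *m D *m P) = char_poly D.
Proof.
move=> Pu; rewrite /char_poly.
have -> : char_poly_mx (invmx P *m D *m P) =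
    map_mx polyC (invmx P) *m char_poly_mx D *m map_mx polyC P.
  rewrite /char_poly_mx mulmxBr mulmxBl -!map_mxM; congr (_ - _).
  by rewrite -mulmxA mul_scalar_mx -scalemxAr -map_mxM mulVmx // map_mx1 scalemx1.
rewrite !det_mulmx mulrAC -det_mulmx -map_mxM mulVmx //.
by rewrite map_mx1 det1 mul1r.
Qed.

(** The principal submatrix on the support of D is an invertible diagonal
    matrix of that size. *)
Lemma card_support_le_rank_diag (F : fieldType) n (D : 'rV[F]_n) :
  (#|[pred k | D 0%R k != 0%R]| <= \rank (diag_mx D))%N.
Proof.
set S := [pred k | _]; pose f (i : 'I_#|S|) : 'I_n := enum_val i.
have subE : rowsub f 1%:M *m diag_mx D *m colsub f 1%:M = diag_mx (\row_i D 0 (f i)).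
  rewrite mulmx_colsub mulmx1 mul_rowsub_mx mul1mx.
  apply/matrixP => i j; rewrite !mxE; congr (_ *+ _).
  by rewrite (inj_eq enum_val_inj).
have /mxrank_unit <- : diag_mx (\row_i D 0 (f i)) \in unitmx.
  rewrite unitmxE det_diag unitfE; apply/prodf_neq0 => i _.
  by rewrite mxE; have := enum_valP i; rewrite inE.
by rewrite -subE (leq_trans (mxrankM_maxl _ _)) ?mxrankM_maxr.
Qed.

(** Unique factorization makes l a rearrangement of the spectrum, so the rows
    of a diagonalizing unitary matrix can be permuted to follow the order
    of l. *)
Lemma hermitian_eigenbasis (C : numClosedFieldType) n (M : 'M[C]_n) (l : seq C) :
  M \is hermsymmx -> char_poly M = \prod_(a <- l) ('X - a%:P) ->
  exists2 P : 'M[C]_n, P \is unitarymx &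
    P *m M *m P ^t* = diag_mx (\row_i l`_i).
Proof.
move=> /hermitian_normalmx/orthomx_spectralP Mdiag charM.
set S := spectralmx M in Mdiag; set D := spectral_diag M in Mdiag.
have S_unitary : S \is unitarymx := spectral_unitarymx M.
have : perm_eq l [tuple D 0 i | i < n].
  apply: prod_XsubC_eq; rewrite -charM Mdiag char_poly_conj ?spectral_unit //.
  rewrite char_poly_trig ?diag_mx_is_trig // big_tuple.
  by apply: eq_bigr => i _; rewrite tnth_mktuple mxE eqxx.
case/tuple_permP => p lE; exists (row_perm p S).
  apply/unitarymxP/matrixP => i j.
  have /unitarymxP/matrixP/(_ (p i) (p j)) := S_unitary.
  rewrite !mxE (inj_eq perm_inj) => <-.
  by apply: eq_bigr => k _; rewrite !mxE.
have SMS : S *m M *m S ^t* = diag_mx D.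
  rewrite Mdiag invmx_unitary // !mulmxA; move/unitarymxP: S_unitary => SS.
  by rewrite SS mul1mx -mulmxA SS mulmx1.
apply/matrixP => i j; move/matrixP/(_ (p i) (p j)) : SMS.
have lpE (k : 'I_n) : l`_k = D 0 (p k).
  by rewrite lE (nth_map k) ?size_enum_ord // nth_ord_enum tnth_mktuple.
rewrite !mxE (inj_eq perm_inj) lpE => <-.
apply: eq_bigr => k _; rewrite !mxE; congr (_ * _).
by apply: eq_bigr => m _; rewrite !mxE.
Qed.

Definition psdmx (C : numClosedFieldType) n (B : 'M[C]_n) :=
  forall v : 'rV[C]_n, 0 <= (v *m B *m v ^t*) 0 0.

Lemma diag_conj_unitary_psd (C : numClosedFieldType) n (B P : 'M[C]_n) i :
  psdmx B -> 0 <= (P *m B *m P ^t*) i i.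
Proof.
move=> /(_ (row i P)); rewrite -row_mul !mxE.
by congr (0 <= _); apply: eq_bigr => j _; rewrite !mxE.
Qed.

Lemma mxtrace_conj_unitary (C : numClosedFieldType) n (M P : 'M[C]_n) :
  P \is unitarymx -> \tr (P *m M *m P ^t*) = \tr M.
Proof.
by move=> Pu; rewrite mxtrace_mulC mulmxA -invmx_unitary // mulVmx
  ?unitarymx_unit // mul1mx.
Qed.

Lemma sum_sqr_norm_row_unitary (C : numClosedFieldType) n (P : 'M[C]_n) i :
  P \is unitarymx -> \sum_k `|P i k| ^+ 2 = 1.
Proof.
move=> /unitarymxP/matrixP/(_ i i); rewrite [RHS]mxE eqxx mulr1n => <-.
by rewrite mxE; apply: eq_bigr => k _; rewrite !mxE normCK.
Qed.

(** With q_i = 1 for r <= i and 0 otherwise, p - q is nonnegative below r and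
    nonpositive from r on.  As l decreases, replacing each l_i by l_r lowers
    the sum of the (p_i - q_i) l_i, and l_r times the sum of the p_i - q_i is
    nonnegative. *)
Lemma sorted_sum_tail_le (R : numDomainType) n r (l : seq R) (p : 'I_n -> R) :
  size l = n -> sorted >=%R l -> (forall i : 'I_n, 0 <= l`_i) ->
  (forall i, 0 <= p i <= 1) -> (n - r)%:R <= \sum_i p i ->
  \sum_(r <= i < n) l`_i <= \sum_i p i * l`_i.
Proof.
move=> sz_l sort_l l_ge0 p01 sum_p.
have [le_nr|lt_rn] := leqP n r.
  rewrite big_geq // sumr_ge0 // => i _.
  by rewrite mulr_ge0 //; case/andP: (p01 i).
have l_mono i j : (i <= j < n)%N -> l`_j <= l`_i.
  move=> /andP[ij jn]; apply: (sorted_leq_nth ge_trans ge_refl) => //;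
  by rewrite inE sz_l // (leq_ltn_trans ij).
have tailE (F : nat -> R) : \sum_(r <= i < n) F i = \sum_(i < n) (r <= i)%N%:R * F i.
  rewrite (big_nat_widenl _ 0) // big_mkord big_mkcond /=.
  by apply: eq_bigr => i _; case: leqP; rewrite ?mul1r ?mul0r.
rewrite tailE -subr_ge0 -sumrB.
have step (i : 'I_n) : (p i - (r <= i)%N%:R) * l`_r <= p i * l`_i - (r <= i)%N%:R * l`_i.
  rewrite -mulrBl; have /andP[p0 p1] := p01 i; case: leqP => ri.
    by rewrite ler_wnM2l ?subr_le0 // l_mono // ri ltn_ord.
  by rewrite subr0 ler_wpM2l // l_mono // (ltnW ri).
apply: le_trans (ler_sum _ (fun i _ => step i)).
rewrite -mulr_suml mulr_ge0 ?(l_ge0 (Ordinal lt_rn)) // sumrB subr_ge0.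
suff <- : (n - r)%:R = \sum_(i < n) (r <= i)%N%:R :> R by [].
transitivity (\sum_(i < n) (r <= i)%N%:R * (1 : R)).
  by rewrite -(tailE (fun=> 1)) sumr_const_nat.
by apply: eq_bigr => i _; rewrite mulr1.
Qed.

Lemma psd_eigenvalue_ge0 (C : numClosedFieldType) n (M : 'M[C]_n) (l : seq C) :
  M \is hermsymmx -> psdmx M ->
  char_poly M = \prod_(a <- l) ('X - a%:P) -> forall i : 'I_n, 0 <= l`_i.
Proof.
move=> M_herm M_psd charM i.
have [P _ /matrixP/(_ i i)] := hermitian_eigenbasis M_herm charM.
by have := diag_conj_unitary_psd P i M_psd => /[swap] ->; rewrite !mxE eqxx.
Qed.

(** Ky Fan's inequality in the form needed here.  Compressing to the kernel of
    A, whose dimension is at least n - r, kills A and can only lower the trace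
    of B, whereas the trace of a compression of A + B to a space of that
    dimension is at least the sum of the n - r smallest eigenvalues. *)
Lemma sum_tail_eigenvalues_le_mxtrace (C : numClosedFieldType) n r
    (A B : 'M[C]_n) (l : seq C) :
  A \is hermsymmx -> A + B \is hermsymmx -> (\rank A <= r)%N ->
  psdmx B -> psdmx (A + B) -> sorted >=%R l ->
  char_poly (A + B) = \prod_(a <- l) ('X - a%:P) ->
  \sum_(r <= i < n) l`_i <= \tr B.
Proof.
move=> A_herm M_herm rankA B_psd M_psd sort_l charM.
have sz_l : size l = n.
  by apply/succn_inj; rewrite -(size_char_poly (A + B)) charM size_prod_XsubC.
have [P Pu PMP] := hermitian_eigenbasis M_herm charM.
set U := spectralmx A; set D := spectral_diag A.
have Uu : U \is unitarymx := spectral_unitarymx A.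
have /hermitian_normalmx/orthomx_spectralP AE := A_herm.
rewrite -/U -/D in AE.
pose E := diag_mx (\row_k (D 0 k == 0)%:R) : 'M[C]_n.
have UUt : U *m U ^t* = 1%:M by apply/unitarymxP.
have PtP : P ^t* *m P = 1%:M.
  by rewrite -invmx_unitary // mulVmx // unitarymx_unit.
(* As U diagonalizes A and E selects the zeros of the spectrum D of A, Q is
   the orthogonal projection onto the kernel of A. *)
pose Q := U ^t* *m E *m U; pose S := P *m U ^t*.
have Su : S \is unitarymx by rewrite mul_unitarymx // trmxC_unitary.
have QA : Q *m A = 0.
  rewrite AE invmx_unitary // /Q -!mulmxA (mulmxA U) UUt mul1mx.
  rewrite (mulmxA E) mulmx_diag.
  have -> : diag_mx (\row_k ((\row_k0 (D 0 k0 == 0)%:R : 'rV[C]_n) 0 k * D 0 k)) = 0.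
    apply/matrixP => i j; rewrite !mxE.
    by case: eqP => [->|_]; rewrite ?mulr0 ?mul0r ?mul0rn.
  by rewrite mul0mx mulmx0.
have PQP_E : P *m U ^t* *m E *m U *m P ^t* = S *m E *m S ^t*.
  by rewrite /S trmx_mul map_mxM trmxCK !mulmxA.
(* The diagonal of Q in the eigenbasis P of A + B. *)
pose p i := (S *m E *m S ^t*) i i.
have pE i : p i = \sum_k (D 0 k == 0)%:R * `|S i k| ^+ 2.
  rewrite /p mxE; apply: eq_bigr => k _.
  by rewrite mul_mx_diag !mxE normCK mulrAC mulrC.
have sumS i : \sum_k `|S i k| ^+ 2 = 1.
  exact: sum_sqr_norm_row_unitary.
have p01 i : 0 <= p i <= 1.
  rewrite pE; apply/andP; split.
    by apply: sumr_ge0 => k _; rewrite mulr_ge0 ?ler0n ?exprn_ge0.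
  rewrite -[leRHS](sumS i); apply: ler_sum => k _.
  by case: (D 0 k == 0); rewrite ?mul1r ?mul0r ?exprn_ge0.
have sum_p : (n - r)%:R <= \sum_i p i.
  rewrite -[\sum_i _]/(\tr _) mxtrace_conj_unitary // mxtrace_diag.
  under eq_bigr do rewrite mxE.
  rewrite -natr_sum ler_nat leq_subLR.
  rewrite -[X in (X <= _)%N]card_ord -(cardC [pred k | D 0 k != 0]) leq_add //.
    apply: leq_trans (card_support_le_rank_diag D) _.
    rewrite (leq_trans _ rankA) //.
    have -> : diag_mx D = U *m A *m U ^t*.
      by rewrite AE invmx_unitary // !mulmxA UUt mul1mx -mulmxA UUt mulmx1.
    by rewrite (leq_trans (mxrankM_maxl _ _)) ?mxrankM_maxr.
  rewrite -sum1_card big_mkcond /= leq_sum // => k _.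
  by rewrite !inE negbK; case: eqP.
have l_ge0 := psd_eigenvalue_ge0 M_herm M_psd charM.
apply: le_trans (sorted_sum_tail_le sz_l sort_l l_ge0 p01 sum_p) _.
have -> : \sum_i p i * l`_i = \tr (Q *m (A + B)).
  have <- : P ^t* *m diag_mx (\row_i l`_i) *m P = A + B.
    by rewrite -PMP !mulmxA PtP mul1mx -mulmxA PtP mulmx1.
  rewrite !mulmxA mxtrace_mulC !mulmxA PQP_E mul_mx_diag.
  by apply: eq_bigr => i _; rewrite [RHS]mxE; congr (_ * _); rewrite mxE.
rewrite mulmxDr QA add0r /Q -!mulmxA mxtrace_mulC -!mulmxA mul_diag_mx.
rewrite -(mxtrace_conj_unitary B Uu) -mulmxA; apply: ler_sum => k _.
have := diag_conj_unitary_psd U k B_psd; rewrite -mulmxA => UBU_ge0.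
rewrite [leLHS]mxE [X in X * _]mxE.
by case: (D 0 k == 0); rewrite ?mul1r ?mul0r.
Qed.

End hermitian.

(** * Transfer to real symmetric matrices *)

Definition real_psdmx (R : numDomainType) n (B : 'M[R]_n) :=
  forall v : 'rV[R]_n, 0 <= (v *m B *m v^T) 0 0.

Section complexification.
Context (R : rcfType) (n : nat).
Local Open Scope sesquilinear_scope.
Implicit Types (A B M : 'M[R]_n) (l : seq R).
Local Notation toC := (map_mx (real_complex R)).

Lemma complexify_hermsym M : M^T = M -> toC M \is hermsymmx.
Proof.
move=> symM; apply: realsym_hermsym.
  apply/is_hermitianmxP; rewrite expr0 scale1r map_mx_id //.
  by rewrite map_trmx symM.
by apply/mxOverP => i j; rewrite mxE; apply/complex_realP; exists (M i j).
Qed.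

(** For v = a + ib the two cross terms of v M v^* cancel by symmetry of M, which
    leaves the sum of the real quadratic forms at a and b. *)
Lemma complexify_psd M : M^T = M -> real_psdmx M -> psdmx (toC M).
Proof.
move=> symM M_psd v.
pose a := map_mx (@complex.Re R) v; pose b := map_mx (@complex.Im R) v.
have vE : v = toC a + 'i%C *: toC b.
  by apply/rowP => i; rewrite !mxE [LHS]complexE.
have vtE : v ^t* = toC a^T - 'i%C *: toC b^T.
  apply/colP => i; rewrite !mxE; case: (v 0 i) => x y /=.
  by rewrite /= [_^*]/=; simpc.
have abE : b *m M *m a^T = a *m M *m b^T.
  rewrite [RHS]mx11_scalar -tr_scalar_mx -mx11_scalar.
  by rewrite !trmx_mul trmxK symM mulmxA.
rewrite vtE {1}vE !mulmxDl mulmxBr mulmxBr -!scalemxAl -!scalemxAr -!map_mxM abE.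
rewrite scalerA -expr2 sqr_i scaleN1r opprK addrA subrK.
rewrite -map_mxD mxE ler0c mxE addr_ge0 //; exact: M_psd.
Qed.

Lemma char_poly_complexify M l : char_poly M = \prod_(a <- l) ('X - a%:P) ->
  char_poly (toC M) = \prod_(a <- map (real_complex R) l) ('X - a%:P).
Proof.
move=> charM; rewrite -map_char_poly charM rmorph_prod big_map.
by apply: eq_bigr => a _; rewrite rmorphB /= map_polyX map_polyC.
Qed.

Lemma nth_map_real_complex l i : (map (real_complex R) l)`_i = (l`_i)%:C%C.
Proof. by elim: l i => [|a l IHl] [|i] //=. Qed.

Lemma real_psd_eigenvalue_ge0 M l : M^T = M -> real_psdmx M ->
  char_poly M = \prod_(a <- l) ('X - a%:P) -> forall i : 'I_n, 0 <= l`_i.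
Proof.
move=> symM M_psd charM i.
have := psd_eigenvalue_ge0 (complexify_hermsym symM) (complexify_psd symM M_psd)
  (char_poly_complexify charM) i.
by rewrite nth_map_real_complex ler0c.
Qed.

Lemma real_sum_tail_eigenvalues_le_mxtrace r A B l :
  A^T = A -> B^T = B -> (\rank A <= r)%N -> real_psdmx B -> real_psdmx (A + B) ->
  sorted >=%R l -> char_poly (A + B) = \prod_(a <- l) ('X - a%:P) ->
  \sum_(r <= i < n) l`_i <= \tr B.
Proof.
move=> symA symB rankA B_psd M_psd sort_l charM.
have symM : (A + B)^T = A + B by rewrite linearD /= symA symB.
rewrite -lecR rmorph_sum -trace_map_mx.
under eq_bigr do rewrite /= -nth_map_real_complex.
apply: (@sum_tail_eigenvalues_le_mxtrace _ _ _ (toC A)).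
- exact: complexify_hermsym.
- by rewrite -map_mxD complexify_hermsym.
- by rewrite mxrank_map.
- exact: complexify_psd.
- by rewrite -map_mxD; apply: complexify_psd.
- by rewrite sorted_map (eq_sorted (e' := >=%R)) // => a b /=; rewrite lecR.
- by rewrite -map_mxD (char_poly_complexify charM).
Qed.

End complexification.

(** * Truncating the kernel expansion *)

Section kernel.
Context {R : realType} {T : Type}.
Context (K : T -> T -> R) (mu : nat -> R) (phi : nat -> T -> R).

Definition head_kernel m x y : R := \sum_(0 <= i < m) mu i * phi i x * phi i y.
Definition tail_kernel m x y : R := K x y - head_kernel m x y.

Context (K_expansion : forall x x',
  series (fun i => mu i * phi i x * phi i x') @ \oo --> K x x').
Context (mu_ge0 : forall i, 0 <= mu i).

Lemma tail_kernel_limit m x y :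
  (fun N => \sum_(m <= i < N) mu i * phi i x * phi i y) @ \oo --> tail_kernel m x y.
Proof.
have cvgK : (fun N => series (fun i => mu i * phi i x * phi i y) N
    - head_kernel m x y) @ \oo --> tail_kernel m x y.
  by apply: cvgB; [exact: K_expansion|exact: cvg_cst].
apply: cvg_trans cvgK; apply: near_eq_cvg; near=> N.
rewrite seriesEnat /= (@big_cat_nat _ _ _ m) //=; first by rewrite addrAC subrr add0r.
by near: N; exists m.
Unshelve. all: by end_near. Qed.

Lemma tail_kernel_sym m x y : tail_kernel m x y = tail_kernel m y x.
Proof.
have := @tail_kernel_limit m y x.
have -> : (fun N => \sum_(m <= i < N) mu i * phi i y * phi i x) =
          (fun N => \sum_(m <= i < N) mu i * phi i x * phi i y).
  by apply/funext => N; apply: eq_bigr => i _; rewrite mulrAC.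
by move=> cvg_yx; apply: cvg_unique (@tail_kernel_limit m x y) cvg_yx.
Qed.

(** The quadratic form of a partial sum of the expansion is a combination of
    squares with coefficients mu_i; nonnegativity passes to the limit. *)
Lemma tail_kernel_psd m n (x : 'I_n -> T) (v : 'I_n -> R) :
  0 <= \sum_j \sum_k v j * v k * tail_kernel m (x j) (x k).
Proof.
have cvgQ : (fun N => \sum_j \sum_k v j * v k *
      \sum_(m <= i < N) mu i * phi i (x j) * phi i (x k)) @ \oo -->
    \sum_j \sum_k v j * v k * tail_kernel m (x j) (x k).
  apply: cvg_big => [|j _]; first exact: add_continuous.
  apply: cvg_big => [|k _]; first exact: add_continuous.
  by apply: cvgMl_tmp; exact: tail_kernel_limit.
apply: cvgr_to_ge cvgQ _; apply: nearW => N.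
have -> : \sum_j \sum_k v j * v k *
      (\sum_(m <= i < N) mu i * phi i (x j) * phi i (x k)) =
    \sum_(m <= i < N) mu i * (\sum_j v j * phi i (x j)) ^+ 2.
  under eq_bigr do under eq_bigr do rewrite mulr_sumr.
  under eq_bigr do rewrite exchange_big /=.
  rewrite exchange_big /=; apply: eq_bigr => i _.
  rewrite expr2 big_distrlr /= mulr_sumr; apply: eq_bigr => j _.
  rewrite mulr_sumr; apply: eq_bigr => k _.
  by rewrite -[mu i * _ * _]mulrA mulrCA mulrACA.
by apply: sumr_ge0 => i _; rewrite mulr_ge0 // sqr_ge0.
Qed.

Lemma tail_kernel_diag_le m b t x :
  (forall i y, `|phi i y| <= b) -> (forall N, \sum_(m <= i < N) mu i <= t) ->
  tail_kernel m x x <= b ^+ 2 * t.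
Proof.
move=> phi_le mu_le; apply: cvgr_to_le (@tail_kernel_limit m x x) _.
apply: nearW => N; apply: (@le_trans _ _ (b ^+ 2 * \sum_(m <= i < N) mu i)).
  rewrite mulr_sumr; apply: ler_sum => i _.
  rewrite -mulrA mulrC ler_wpM2r // -expr2 -(real_normK (num_real _)).
  by rewrite lerXn2r ?nnegrE // (le_trans _ (phi_le i x)).
by rewrite ler_wpM2l // sqr_ge0.
Qed.

Context (n : nat) (x : 'I_n -> T).

Lemma empirical_kernel_split m : empirical_kernel K x =
  empirical_kernel (head_kernel m) x + empirical_kernel (tail_kernel m) x.
Proof. by apply/matrixP => i j; rewrite !mxE -mulrDr subrKC. Qed.

Lemma rank_empirical_head_kernel m :
  (\rank (empirical_kernel (head_kernel m) x) <= m)%N.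
Proof.
have -> : empirical_kernel (head_kernel m) x =
    (\matrix_(j < n, i < m) (n%:R^-1 * (mu i * phi i (x j)))) *m
    (\matrix_(i < m, k < n) phi i (x k)).
  apply/matrixP => j k; rewrite !mxE mulr_sumr big_mkord.
  by apply: eq_bigr => i _; rewrite !mxE !mulrA.
exact: leq_trans (mxrankM_maxl _ _) (rank_leq_col _).
Qed.

Lemma tr_empirical_kernel (L : T -> T -> R) :
  (forall y z, L y z = L z y) -> (empirical_kernel L x)^T = empirical_kernel L x.
Proof. by move=> symL; apply/matrixP => i j; rewrite !mxE symL. Qed.

Lemma empirical_tail_kernel_psd m : real_psdmx (empirical_kernel (tail_kernel m) x).
Proof.
move=> v; rewrite mxE.
have -> : \sum_k (v *m empirical_kernel (tail_kernel m) x) 0 k * v^T k 0 =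
    n%:R^-1 * \sum_j \sum_k v 0 j * v 0 k * tail_kernel m (x j) (x k).
  rewrite exchange_big mulr_sumr; apply: eq_bigr => k _.
  rewrite !mxE mulr_suml mulr_sumr; apply: eq_bigr => j _.
  by rewrite !mxE mulrCA -!mulrA; congr (_ * (_ * _)); rewrite mulrC.
by rewrite mulr_ge0 ?invr_ge0 ?ler0n ?tail_kernel_psd.
Qed.

Lemma empirical_kernel_tail0 : empirical_kernel K x = empirical_kernel (tail_kernel 0) x.
Proof.
by apply/matrixP => i j; rewrite !mxE /tail_kernel /head_kernel big_geq // subr0.
Qed.

Lemma tr_empirical_kernel_full : (empirical_kernel K x)^T = empirical_kernel K x.
Proof. by rewrite empirical_kernel_tail0 tr_empirical_kernel //; exact: tail_kernel_sym. Qed.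

Lemma empirical_kernel_psd : real_psdmx (empirical_kernel K x).
Proof. by rewrite empirical_kernel_tail0; exact: empirical_tail_kernel_psd. Qed.

Lemma mxtrace_empirical_kernel_le (L : T -> T -> R) t : 0 <= t ->
  (forall y, L y y <= t) -> \tr (empirical_kernel L x) <= t.
Proof.
move=> t_ge0 L_le; apply: (@le_trans _ _ (\sum_(i < n) n%:R^-1 * t)).
  by apply: ler_sum => i _; rewrite mxE ler_wpM2l ?invr_ge0 ?ler0n.
rewrite sumr_const card_ord -mulrnAl -[leRHS]mul1r ler_wpM2r //.
rewrite -mulr_natr; case: (n) => [|n']; first by rewrite mulr0.
by rewrite mulVf ?pnatr_eq0.
Qed.

(** A term counted on the left is at most lam.  The first m indices are charged
    lam each, the others are charged to the trace of the tail kernel matrix,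
    the head kernel having rank at most m.  As these charges are nonnegative,
    an index that is not counted may be charged too. *)
Lemma sum_small_empirical_eigenvalues_le m b t lam (l : seq R) :
  (forall i y, `|phi i y| <= b) -> (forall N, \sum_(m <= i < N) mu i <= t) ->
  0 <= lam -> sorted >=%R l ->
  char_poly (empirical_kernel K x) = \prod_(a <- l) ('X - a%:P) ->
  \sum_(shat_rank l lam <= i < n) l`_i <= m%:R * lam + b ^+ 2 * t.
Proof.
move=> phi_le mu_le lam_ge0 sort_l charK.
have t_ge0 : 0 <= t by have := mu_le 0%N; rewrite big_geq.
have sz_l : size l = n.
  by apply/succn_inj; rewrite -(size_char_poly (empirical_kernel K x)) charK
    size_prod_XsubC.
have l_ge0 := real_psd_eigenvalue_ge0 tr_empirical_kernel_full empirical_kernel_psd charK.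
have tailE r : \sum_(r <= i < n) l`_i = \sum_(i < n) (if (r <= i)%N then l`_i else 0).
  by rewrite (big_nat_widenl _ 0) // big_mkord big_mkcond.
apply: (@le_trans _ _ (\sum_(i < n) (if (i < m)%N then lam else 0) +
    \sum_(m <= i < n) l`_i)).
  rewrite !tailE -big_split /=; apply: ler_sum => i _.
  have l_le_lam : (shat_rank l lam <= i)%N -> l`_i <= lam.
    move=> shat_le; have shat_lt : (shat_rank l lam < size l)%N.
      by rewrite sz_l (leq_ltn_trans shat_le).
    apply: le_trans (nth_find 0 (_ : has (fun a => a <= lam) l)); last first.
      by rewrite has_find.
    by apply: (sorted_leq_nth ge_trans ge_refl) => //; rewrite inE ?sz_l.
  have [im|mi] := ltnP i m; last by rewrite add0r; case: ifP.
  by rewrite addr0; case: ifP.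
apply: lerD.
  have [le_mn|/ltnW le_nm] := leqP m n.
    rewrite -big_mkcond -(big_ord_widen n (fun=> lam) le_mn).
    by rewrite sumr_const card_ord mulr_natl.
  apply: (@le_trans _ _ (\sum_(i < n) lam)).
    by apply: ler_sum => i _; case: ifP.
  by rewrite sumr_const card_ord -[leLHS]mulr_natl ler_wpM2r // ler_nat.
apply: (@le_trans _ _ (\tr (empirical_kernel (tail_kernel m) x))).
  apply: (@real_sum_tail_eigenvalues_le_mxtrace _ _ _
    (empirical_kernel (head_kernel m) x)) => //.
  - apply: tr_empirical_kernel => y z.
    by apply: eq_bigr => i _; rewrite mulrAC.
  - by apply: tr_empirical_kernel => y z; exact: tail_kernel_sym.
  - exact: rank_empirical_head_kernel.
  - exact: empirical_tail_kernel_psd.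
  - by rewrite -empirical_kernel_split; exact: empirical_kernel_psd.
  - by rewrite -empirical_kernel_split.
apply: mxtrace_empirical_kernel_le => [|y]; first by rewrite mulr_ge0 ?sqr_ge0.
exact: tail_kernel_diag_le.
Qed.
End kernel.

(** * Consequences of Assumption A1 *)

Lemma assumption_A1_phi_bounded (R : realType) (T : Type) (mu : nat -> R)
    (phi : nat -> T -> R) :
  assumption_A1 mu phi -> exists b : R, forall i y, `|phi i y| <= b.
Proof.
case=> + _; set S := ereal_sup _ => S_lty.
have phi_le i y : (`|phi i y|%:E <= S)%E.
  by apply: (@le_trans _ _ (sup_norm (phi i))); apply: ereal_sup_ubound; eexists.
case: S S_lty phi_le => // [b _ phi_le|_ phi_le].
  by exists b => i y; rewrite -lee_fin.
(* A supremum equal to -oo occurs only for empty T. *)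
by exists 0 => i y; have := phi_le i y.
Qed.

Lemma assumption_A1_tail_bounded (R : realType) (T : Type) (mu : nat -> R)
    (phi : nat -> T -> R) : (forall i, 0 <= mu i) ->
  assumption_A1 mu phi -> exists2 c : R, 0 <= c & forall k N, (0 < k)%N ->
    0 < mu k.-1 -> \sum_(k <= i < N) mu i <= c * (k%:R * mu k.-1).
Proof.
move=> mu_ge0 [_]; set S := ereal_sup _ => S_lty.
have ratio_le k : (0 < k)%N ->
    ((\sum_(k <= i <oo) (mu i)%:E) / (k%:R * mu k.-1)%:E <= S)%E.
  by move=> k_gt0; apply: ereal_sup_ubound; exists k.
exists (Num.max 0 (fine S)); first by rewrite le_max lexx.
move=> k N k_gt0 mu_gt0; have kmu_gt0 : 0 < k%:R * mu k.-1 by rewrite mulr_gt0 ?ltr0n.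
have := ratio_le k k_gt0; rewrite inver gt_eqF //.
have := @nneseries_lim_ge _ (EFin \o mu) xpredT k N (fun i _ _ => mu_ge0 i).
rewrite sumEFin => partial_le; rewrite lee_pdivrMr //.
move=> /(le_trans partial_le).
case: S S_lty {ratio_le} => //= [c _|_].
  rewrite -EFinM lee_fin => /le_trans; apply; rewrite ler_wpM2r ?(ltW kmu_gt0) //.
  by rewrite le_max lexx orbT.
by rewrite gt0_mulNye ?lte_fin.
Qed.

Theorem lemma3p1 (R : realType) (d : nat) (X : set (d.-tuple R)) (x0 : X)
    (PX : probability (trace_space x0) R)
    (H : set (trace_space x0 -> R))
    (ip : (trace_space x0 -> R) -> (trace_space x0 -> R) -> R)
    (K : trace_space x0 -> trace_space x0 -> R)
    (mu : nat -> R) (phi : nat -> trace_space x0 -> R)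
    (HK : is_rkhs H ip K)
    (HL2 : forall f, H f -> f \in Lfun PX 2%:E)
    (mu_ge0 : forall i, 0 <= mu i)
    (mu_noninc : nonincreasing_seq mu)
    (K_expansion : forall x x',
       series (fun i => mu i * phi i x * phi i x') @ \oo --> K x x')
    (phi_basis : is_L2_orthonormal_basis PX phi)
    (phi_H : forall i, 0 < mu i -> H (phi i))
    (phi_orthoH : forall i j, 0 < mu i -> 0 < mu j ->
       ip (phi i) (phi j) = (i == j)%:R / mu i)
    (A1 : assumption_A1 mu phi) :
  exists2 C : R, 0 < C &
    forall lam : nat -> R, lam @ \oo --> 0 ->
    forall n : nat, (0 < n)%N -> n%:R^-1 < lam n ->
    forall (dO : measure_display) (Omega : measurableType dO)
      (P : probability Omega R) (x : 'I_n -> {RV P >-> trace_space x0}),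
      iid PX x ->
      let s := s_rank mu (lam n) in
      let muhat w := ordered_eigenvalues (empirical_kernel K (fun i => x i w)) in
      ((1 - 4 * expR (- s%:R))%:E <=
       P [set w | (\sum_(shat_rank (muhat w) (lam n) <= i < n) (muhat w)`_i <=
                   C * s%:R * mu s.-1)%R])%E.
Proof.
have [b phi_le] := assumption_A1_phi_bounded A1.
have [c c_ge0 tail_le] := assumption_A1_tail_bounded mu_ge0 A1.
exists (1 + b ^+ 2 * c); first by rewrite ltr_wpDr // mulr_ge0 ?sqr_ge0.
move=> lam _ n n_gt0 lam_gt dO Omega P x _; cbv zeta.
set s := s_rank mu (lam n).
have lam_ge0 : 0 <= lam n by rewrite (le_trans _ (ltW lam_gt)) ?invr_ge0 ?ler0n.
have [s_eq0|s_gt0] := posnP s.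
  rewrite s_eq0 oppr0 expR0 mulr1; apply: le_trans (measure_ge0 _ _).
  by rewrite lee_fin subr_le0 ler1n.
have lam_lt : lam n < mu s.-1.
  (* Only a positive s is known to satisfy its defining property: 0 is also
     the default value. *)
  rewrite ltNge; apply/negP => mu_le; move: s_gt0.
  rewrite /s /s_rank in mu_le *; move: mu_le; case: xgetP => // i _ [_ i_min].
  by move=> /i_min; case: i {i_min} => //= i; rewrite ltnn.
set E := [set w | _]; suff -> : E = setT.
  by rewrite probability_setT lee_fin lerBlDr lerDl mulr_ge0 ?expR_ge0.
rewrite -subTset => w _; rewrite /E /=.
have s_lam : s%:R * lam n <= s%:R * mu s.-1 by rewrite ler_wpM2l ?ler0n ?ltW.
rewrite -mulrA mulrDl mul1r -mulrA /ordered_eigenvalues.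
case: xgetP => [l _ [sort_l charK]|_].
  have tail_s N := tail_le s N s_gt0 (le_lt_trans lam_ge0 lam_lt).
  have small_le := sum_small_empirical_eigenvalues_le K_expansion mu_ge0 phi_le
    tail_s lam_ge0 sort_l charK.
  apply: le_trans small_le _.
  by rewrite lerD2r.
(* Without a factorization the list of eigenvalues defaults to the empty one. *)
rewrite big1 => [|i _]; last by rewrite nth_nil.
have smu_ge0 : 0 <= s%:R * mu s.-1.
  by rewrite mulr_ge0 ?ler0n // (ltW (le_lt_trans lam_ge0 lam_lt)).
by rewrite addr_ge0 // mulr_ge0 ?sqr_ge0 // mulr_ge0.
Qed.
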